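(* Let $S$ be a right $\pi$-inverse ordered semigroup. Then the following conditions are equivalent: (1) $\mathcal{R}^*$ is a congruence on $S$; (2) $\mathcal{L}^*\subseteq\mathcal{R}^*$; (3) $S$ is a semilattice of right $\pi$-$t$-simple ordered semigroups; (4) $\mathcal{R}^*$ is a semilattice congruence on $S$.
   Context: An ordered semigroup $(S,\cdot,\leq)$ is a (nonempty) semigroup with a partial order such that $a\leq b$ implies $xa\leq xb$ and $ax\leq bx$ for all $a,b,x\in S$. $\mathbb{N}$ denotes the positive integers. For $A\subseteq S$, $(A]=\{x\in S: x\leq a \text{ for some } a\in A\}$. A subsemigroup is regarded as an ordered semigroup with the restricted order. $S$ is $\pi$-regular if for every $a\in S$ there is $m\in\mathbb{N}$ with $a^m\in(a^mSa^m]$. $Reg_\leq(S)=\{a\in S: a\in(aSa]\}$. $E_\leq(S)=\{e\in S: e\leq e^2\}$ is the set of ordered idempotents. $L(a)=(\{a\}\cup Sa]$, $R(a)=(\{a\}\cup aS]$; $a\,\mathcal{L}\,b$ iff $L(a)=L(b)$, and $a\,\mathcal{R}\,b$ iff $R(a)=R(b)$. For $S$ $\pi$-regular, $a\,\mathcal{L}^*\,b$ iff $a^m\,\mathcal{L}\,b^n$, and $a\,\mathcal{R}^*\,b$ iff $a^m\,\mathcal{R}\,b^n$, where $m,n$ are the smallest positive integers such that $a^m,b^n\in Reg_\leq(S)$. A $\pi$-regular ordered semigroup $S$ is right $\pi$-inverse if for every $a\in S$ there is $m\in\mathbb{N}$ such that $(Sa^m]$ is generated by an $\mathcal{R}$-unique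 ordered idempotent, i.e. there is $e\in E_\leq(S)$ with $(Sa^m]=(Se]$, and every $f\in E_\leq(S)$ with $(Sa^m]=(Sf]$ satisfies $e\,\mathcal{R}\,f$. A nonempty $A\subseteq S$ is a right ideal if $AS\subseteq A$ and $(A]=A$; $S$ is right simple if it has no proper right ideal (equivalently $S=(aS]$ for all $a\in S$). $S$ is right $\pi$-$t$-simple if there is a subsemigroup $H$ of $S$ which, as an ordered semigroup, is right simple and $\pi$-regular, such that for every $a\in S$ there is $m\in\mathbb{N}$ with $a^m\in H$. A congruence is an equivalence relation compatible with left and right multiplication. A semilattice congruence is a congruence $\rho$ with $a\,\rho\,a^2$ and $ab\,\rho\,ba$ for all $a,b\in S$. $S$ is a semilattice of ordered semigroups of type $\tau$ if there is a semilattice congruence $\rho$ on $S$ such that each $\rho$-class is a subsemigroup of $S$ of type $\tau$. *)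

(* Defs.v *)
From HB Require Import structures.
From Corelib Require Import RelationClasses.
From mathcomp Require Import all_boot all_order.
From mathcomp Require Import boolp classical_sets.

Set Implicit Arguments.
Unset Strict Implicit.
Unset Printing Implicit Defensive.

Local Open Scope group_scope.
Local Open Scope order_scope.
Local Open Scope classical_set_scope.

HB.mixin Record Semigroup_isOrdered (d : Order.disp_t) (T : Type)
    of Semigroup T & Order.POrder d T := {
  osg_nonempty : [set: T] !=set0;
  osg_le_mul2l : forall x a b : T, a <= b -> x * a <= x * b;
  osg_le_mul2r : forall x a b : T, a <= b -> a * x <= b * x
}.

#[short(type="ordSemigroupType")]
HB.structure Definition OrdSemigroup (d : Order.disp_t) :=
  { T of Semigroup_isOrdered d T & Semigroup T & Order.POrder d T }.

Definition subsemigroup (T : semigroupType) (A : set T) : Prop :=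
  A !=set0 /\ (forall x y, A x -> A y -> A (x * y)).

Section SubOrdSemigroup.
Variables (d : Order.disp_t) (S : ordSemigroupType d).
Variables (A : set S) (hA : subsemigroup A).

(* The argument hA is kept in the type so that the instances below can depend
   on it. *)
Definition subosg of subsemigroup A : Type := {x : S | x \in A}.

Notation T := (subosg hA).

HB.instance Definition _ := SubType.copy T {x : S | x \in A}.
HB.instance Definition _ := Choice.copy T {x : S | x \in A}.

HB.instance Definition _ :=
  Order.SubChoice_isSubPOrder.Build d S (fun x => x \in A) d T.

Fact subosg_mulg_closed : mulg_closed (fun x : S => x \in A).
Proof.
by move=> x y /set_mem Ax /set_mem Ay; apply/mem_set/(proj2 hA).
Qed.

HB.instance Definition _ :=
  SubChoice_isSubSemigroup.Build S (fun x => x \in A) T subosg_mulg_closed.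

Fact subosg_nonempty : [set: T] !=set0.
Proof. by case: (proj1 hA) => x Ax; exists (exist _ x (mem_set Ax)). Qed.

Fact subosg_le_mul2l (x a b : T) : a <= b -> x * a <= x * b.
Proof.
move=> leab; change (val (x * a) <= val (x * b)).
by rewrite !valM; apply: osg_le_mul2l.
Qed.

Fact subosg_le_mul2r (x a b : T) : a <= b -> a * x <= b * x.
Proof.
move=> leab; change (val (a * x) <= val (b * x)).
by rewrite !valM; apply: osg_le_mul2r.
Qed.

HB.instance Definition _ := Semigroup_isOrdered.Build d T
  subosg_nonempty subosg_le_mul2l subosg_le_mul2r.

End SubOrdSemigroup.

Section Notions.
Variables (d : Order.disp_t) (S : ordSemigroupType d).
Implicit Types (a b e f x y : S) (A B : set S) (m n : nat).
Implicit Types rho : S -> S -> Prop.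

(* Meaningful for 0 < m only: a^0 does not exist in a semigroup, and
   [spow a 0] is the junk value a. *)
Definition spow a m : S := iterop m *%g a a.

Definition downset A : set S := [set x | exists2 a, A a & x <= a].

Definition smul A B : set S := [set x * y | x in A & y in B].

Definition regular : set S :=
  [set a | downset (smul (smul [set a] setT) [set a]) a].

Definition pi_regular : Prop :=
  forall a, exists2 m, (0 < m)%N & regular (spow a m).

Definition ord_idempotent : set S := [set e | e <= e * e].

Definition Lideal a : set S := downset ([set a] `|` smul setT [set a]).
Definition Rideal a : set S := downset ([set a] `|` smul [set a] setT).

Definition green_L a b : Prop := Lideal a = Lideal b.
Definition green_R a b : Prop := Rideal a = Rideal b.

Definition least_regular_exponent a m : Prop :=
  [/\ (0 < m)%N, regular (spow a m)
    & forall k, (0 < k)%N -> regular (spow a k) -> (m <= k)%N].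

Definition L_star a b : Prop := exists m n,
  [/\ least_regular_exponent a m, least_regular_exponent b n
    & green_L (spow a m) (spow b n)].
Definition R_star a b : Prop := exists m n,
  [/\ least_regular_exponent a m, least_regular_exponent b n
    & green_R (spow a m) (spow b n)].

Definition right_pi_inverse : Prop :=
  pi_regular /\
  forall a, exists2 m, (0 < m)%N &
    exists e, [/\ ord_idempotent e,
      downset (smul setT [set spow a m]) = downset (smul setT [set e])
    & forall f, ord_idempotent f ->
        downset (smul setT [set spow a m]) = downset (smul setT [set f]) ->
        green_R e f].

Definition right_ideal A : Prop :=
  [/\ A !=set0, smul A setT `<=` A & downset A = A].

Definition right_simple : Prop := forall A, right_ideal A -> A = setT.

Definition congruence rho : Prop :=
  Equivalence rho /\
  (forall x a b, rho a b -> rho (x * a) (x * b) /\ rho (a * x) (b * x)).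

Definition semilattice_congruence rho : Prop :=
  [/\ congruence rho, (forall a, rho a (a * a))
    & forall a b, rho (a * b) (b * a)].

Definition semilattice_of (tau : ordSemigroupType d -> Prop) : Prop :=
  exists2 rho, semilattice_congruence rho &
    forall a, exists hC : subsemigroup [set b | rho a b], tau (subosg hC).

End Notions.

Definition right_pi_t_simple (d : Order.disp_t) (S : ordSemigroupType d) :
    Prop :=
  exists (H : set S) (hH : subsemigroup H),
    [/\ right_simple (subosg hH), pi_regular (subosg hH)
      & forall a : S, exists2 m, (0 < m)%N & H (spow a m)].

(* Main.v *)
Require Import Defs.
From Corelib Require Import RelationClasses.
From mathcomp Require Import all_boot all_order.
From mathcomp Require Import boolp classical_sets.

(** A right pi-inverse semigroup has the property that ordered idempotents
    related by L are related by R.  Hence L* is contained in R* as soon as every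
    regular element a has an x with a <= axa and a R xa, and this follows both
    from (1) and from (3).  Conversely, assume L* is contained in R* and, for a
    regular p, let F(p) be the set of all c with p in (cS].  If p <= v(wp), then
    wp is regular and L-related, hence R-related, to p; this makes F(p) a filter:
    cd lies in F(p) iff c and d do.  For regular powers a^m and b^n we get
    a^m in (b^n S] iff b lies in F(a^m), so R* is the equivalence of a preorder
    for which ab is a meet of a and b, that is, a semilattice congruence.  The
    right simple pi-regular core of the R*-class of a is the intersection of F(p)
    and (p F(p)], where p is a regular power of a. *)

Set Implicit Arguments.
Unset Strict Implicit.
Unset Printing Implicit Defensive.

Local Open Scope group_scope.
Local Open Scope order_scope.
Local Open Scope classical_set_scope.

Import Order.POrderTheory.

(** * Divisibility up to the order, and Green's relations on regular elements *)

Section OrderedSemigroup.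
Variables (d : Order.disp_t) (S : ordSemigroupType d).
Implicit Types (a b c e f p q w x y : S) (m n k : nat).

(** Membership of p in (cS], and below in (Sc]. Unlike the principal ideals, these sets need not
    contain c. *)
Definition in_aS p c := exists w, p <= c * w.
Definition in_Sa p c := exists w, p <= w * c.

Lemma in_aS_trans p q c : in_aS p q -> in_aS q c -> in_aS p c.
Proof.
move=> [w pw] [v qv]; exists (v * w); apply: le_trans pw _.
by rewrite mulgA; apply: osg_le_mul2r.
Qed.

Lemma in_Sa_trans p q c : in_Sa p q -> in_Sa q c -> in_Sa p c.
Proof.
move=> [w pw] [v qv]; exists (w * v); apply: le_trans pw _.
by rewrite -mulgA; apply: osg_le_mul2l.
Qed.

Lemma in_aSM p c x : in_aS p (c * x) -> in_aS p c.
Proof. by move=> [w pw]; exists (x * w); rewrite mulgA. Qed.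

Lemma regularP a : regular a <-> exists x, a <= a * x * a.
Proof.
split=> [[_ [_ [_ -> [x _ <-]] [_ -> <-]] h]|[x h]]; first by exists x.
exists (a * x * a) => //; exists (a * x); last by exists a.
by exists a => //; exists x.
Qed.

Lemma regular_in_aS p : regular p -> in_aS p p.
Proof. by case/regularP=> x h; exists (x * p); rewrite mulgA. Qed.

Lemma regular_in_Sa p : regular p -> in_Sa p p.
Proof. by case/regularP=> x h; exists (p * x). Qed.

Lemma RidealE c x : Rideal c x <-> x <= c \/ in_aS x c.
Proof.
split=> [[_ [->|[_ -> [w _ <-]]] h]|[h|[w h]]]; [by left|by right; exists w| |].
  by exists c => //; left.
by exists (c * w) => //; right; exists c => //; exists w.
Qed.

Lemma LidealE c x : Lideal c x <-> x <= c \/ in_Sa x c.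
Proof.
split=> [[_ [->|[w _ [_ -> <-]]] h]|[h|[w h]]]; [by left|by right; exists w| |].
  by exists c => //; left.
by exists (w * c) => //; right; exists w => //; exists c.
Qed.

Lemma le_in_aS p c : regular p -> p <= c -> in_aS p c.
Proof.
case/regularP=> x h pc; exists (x * p); apply: (le_trans h).
by rewrite -mulgA; apply: osg_le_mul2r.
Qed.

Lemma le_in_Sa p c : regular p -> p <= c -> in_Sa p c.
Proof.
by case/regularP=> x h pc; exists (p * x); apply: (le_trans h); apply: osg_le_mul2l.
Qed.

(** A regular p with p <= c satisfies p <= pxp <= c(xp), so the extra generator of a principal right
    ideal is absorbed by (cS]. *)
Lemma green_R_regularP p q : regular p -> regular q ->
  green_R p q <-> in_aS p q /\ in_aS q p.
Proof.
move=> rp rq; split=> [E|[pq qp]].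
  split.
    have : Rideal q p by rewrite -E; apply/RidealE; left.
    by case/RidealE=> // h; exact: le_in_aS.
  have : Rideal p q by rewrite E; apply/RidealE; left.
  by case/RidealE=> // h; exact: le_in_aS.
have sub u v : in_aS u v -> forall x, Rideal u x -> Rideal v x.
  move=> uv x /RidealE[xu|xu]; apply/RidealE; right.
    by case: uv => w uw; exists w; exact: le_trans xu uw.
  exact: in_aS_trans xu uv.
by apply/seteqP; split; apply: sub.
Qed.

Lemma green_L_regularP p q : regular p -> regular q ->
  green_L p q <-> in_Sa p q /\ in_Sa q p.
Proof.
move=> rp rq; split=> [E|[pq qp]].
  split.
    have : Lideal q p by rewrite -E; apply/LidealE; left.
    by case/LidealE=> // h; exact: le_in_Sa.
  have : Lideal p q by rewrite E; apply/LidealE; left.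
  by case/LidealE=> // h; exact: le_in_Sa.
have sub u v : in_Sa u v -> forall x, Lideal u x -> Lideal v x.
  move=> uv x /LidealE[xu|xu]; apply/LidealE; right.
    by case: uv => w uw; exists w; exact: le_trans xu uw.
  exact: in_Sa_trans xu uv.
by apply/seteqP; split; apply: sub.
Qed.

Lemma ord_idempotent_regular e : ord_idempotent e -> regular e.
Proof.
by move=> ee; apply/regularP; exists e; apply: (le_trans ee); apply: osg_le_mul2r; exact: ee.
Qed.

Lemma ord_idempotent_mulr a x : a <= a * x * a -> ord_idempotent (a * x).
Proof. by move=> h; rewrite /ord_idempotent /= mulgA; apply: osg_le_mul2r. Qed.

Lemma ord_idempotent_mull a x : a <= a * x * a -> ord_idempotent (x * a).
Proof.
by move=> h; rewrite /ord_idempotent /= -mulgA (mulgA a); apply: osg_le_mul2l.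
Qed.

(** * Powers, least regular exponents and the starred relations *)

Lemma spow1 a : spow a 1 = a.
Proof. by []. Qed.

Lemma spowS a m : (0 < m)%N -> spow a m.+1 = a * spow a m.
Proof. by case: m. Qed.

Lemma spow_in_aS a m p : (0 < m)%N -> in_aS p (spow a m) -> in_aS p a.
Proof. by case: m => [//|[//|m]] _; rewrite spowS //; apply: in_aSM. Qed.

Lemma ord_idempotent_le_spow e m :
  ord_idempotent e -> (0 < m)%N -> e <= spow e m.
Proof.
move=> ee; elim: m => [//|[|m] IH] _; first by rewrite spow1.
by rewrite spowS //; apply: (le_trans ee); apply: osg_le_mul2l; apply: IH.
Qed.

Lemma least_regular_exponent_uniq a m n :
  least_regular_exponent a m -> least_regular_exponent a n -> m = n.
Proof.
move=> [m0 rm hm] [n0 rn hn]; apply/eqP.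
by rewrite eqn_leq hm // hn.
Qed.

Lemma least_regular_exponent_regular a : regular a -> least_regular_exponent a 1.
Proof. by []. Qed.

Lemma pi_regular_least_exponent a : pi_regular S ->
  exists m, least_regular_exponent a m.
Proof.
move=> pS; have ex : exists m, (0 < m)%N && `[< regular (spow a m) >].
  by have [m m0 rm] := pS a; exists m; rewrite m0; apply/asboolP.
case: (ex_minnP ex) => m /andP[m0 /asboolP rm] hm.
by exists m; split=> // k k0 rk; apply: hm; rewrite k0; apply/asboolP.
Qed.

Lemma R_star_regular a b : regular a -> regular b -> R_star a b <-> green_R a b.
Proof.
move=> ra rb; split=> [[m [n [am bn]]]|h]; last by exists 1%N, 1%N.
by rewrite -(least_regular_exponent_uniq (least_regular_exponent_regular ra) am)
  -(least_regular_exponent_uniq (least_regular_exponent_regular rb) bn).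
Qed.

(** Both starred relations compare the same regular powers, and a regular element has least regular
    exponent 1. *)
Lemma L_star_sub_R_starP :
  (forall a b, L_star a b -> R_star a b) <->
  (forall a b, regular a -> regular b -> green_L a b -> green_R a b).
Proof.
split=> [h a b ra rb ab|h a b [m [n [am bn ab]]]].
  by apply/R_star_regular => //; apply: h; exists 1%N, 1%N.
by exists m, n; split=> //; apply: h => //; [case: am|case: bn].
Qed.

(** * Uniqueness of idempotent generators in right pi-inverse semigroups *)

Lemma right_pi_inverse_idem_L_R e f : right_pi_inverse S ->
  ord_idempotent e -> ord_idempotent f -> in_Sa e f -> in_Sa f e -> green_R e f.
Proof.
move=> [_ inv] ee ff ef fe; have [m m0 [g [gg Eg Ug]]] := inv e.
have SE c x : downset (smul setT [set c]) x <-> in_Sa x c.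
  split=> [[_ [w _ [_ -> <-]] h]|[w h]]; first by exists w.
  by exists (w * c) => //; exists w => //; exists c.
(* Since e^m ends in e and e <= e e^m, the left ideal (Se^m] equals (Se]. Hence e and f both
   generate it, and both are R-related to g. *)
have Eq h : in_Sa h e -> in_Sa e h ->
    downset (smul setT [set spow e m]) = downset (smul setT [set h]).
  move=> he eh; apply/seteqP; split=> x /SE xs; apply/SE.
    apply: in_Sa_trans xs _; case: m m0 {Eg Ug} => [//|[|m]] _ //.
    apply: in_Sa_trans eh; elim: m => [|m [w hw]]; first by exists e; rewrite spowS.
    by exists (e * w); rewrite spowS // -mulgA; apply: osg_le_mul2l.
  apply: in_Sa_trans xs _; apply: in_Sa_trans he _.
  exists e; apply: (le_trans ee); apply: osg_le_mul2l.
  exact: (ord_idempotent_le_spow ee m0).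
have eSe := regular_in_Sa (ord_idempotent_regular ee).
by rewrite /green_R -(Ug e) ?(Ug f) //; apply: Eq.
Qed.

(** The ordered idempotents xa and yb are L-related to a and b, hence to each other, hence
    R-related; the assumption carries this back to a and b. *)
Lemma regular_L_sub_R : right_pi_inverse S ->
  (forall a, regular a -> exists2 x, a <= a * x * a & green_R a (x * a)) ->
  forall a b, regular a -> regular b -> green_L a b -> green_R a b.
Proof.
move=> inv h a b ra rb /(green_L_regularP ra rb)[ab ba].
have [x ax Ra] := h a ra; have [y by_ Rb] := h b rb.
have Sa : in_Sa a (x * a) by exists a; rewrite mulgA.
have Sb : in_Sa b (y * b) by exists b; rewrite mulgA.
rewrite /green_R Ra Rb; apply: right_pi_inverse_idem_L_R => //.
- exact: ord_idempotent_mull.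
- exact: ord_idempotent_mull.
- by apply: in_Sa_trans (in_Sa_trans ab Sb); exists x.
- by apply: in_Sa_trans (in_Sa_trans ba Sa); exists y.
Qed.

(** * Consequences of R* being a congruence *)

Lemma regular_inverse a : regular a ->
  exists x, a <= a * x * a /\ x <= x * a * x.
Proof.
case/regularP=> x h; exists (x * a * x); split.
  apply: (le_trans h); rewrite !mulgA; apply: osg_le_mul2r.
  by apply: osg_le_mul2r.
have h1 : x * a <= x * a * x * a by rewrite -!mulgA; apply: osg_le_mul2l; rewrite mulgA.
rewrite !mulgA; apply: osg_le_mul2r; apply: (le_trans h1).
by apply: osg_le_mul2r; apply: osg_le_mul2r.
Qed.

(** Multiplying a R* ax by a on the right gives aa R* axa, and axa R* a. *)
Lemma R_star_congruence_sqr a : congruence (@R_star d S) -> regular a ->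
  in_aS a (a * a).
Proof.
move=> [eqR comp] /[dup] ra /regularP[x h].
have rax := ord_idempotent_regular (ord_idempotent_mulr h).
have raxa : regular (a * x * a).
  apply/regularP; exists x; rewrite !mulgA; do 2!apply: osg_le_mul2r.
  by apply: (le_trans h); do 2!apply: osg_le_mul2r.
have R1 : R_star a (a * x).
  apply/R_star_regular => //; apply/green_R_regularP => //; split; first by exists a.
  by apply: in_aSM (regular_in_aS rax).
have R2 : R_star a (a * x * a).
  apply/R_star_regular => //; apply/green_R_regularP => //; split.
    exact: le_in_aS.
  by exists (x * a); rewrite mulgA.
have R3 : R_star a (a * a).
  by apply: Equivalence_Transitive R2 _; apply: Equivalence_Symmetric; exact: (comp a _ _ R1).2.
(* Only a power (aa)^n is known to be regular; a lies in ((aa)^n S], which is contained in (aaS]. *)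
case: R3 => m [n [am [n0 rn _]]].
rewrite -(least_regular_exponent_uniq (least_regular_exponent_regular ra) am) spow1.
by case/(green_R_regularP ra rn) => /(spow_in_aS n0).
Qed.

Lemma in_aS_sqr_inverse a x : right_pi_inverse S -> a <= a * x * a ->
  in_aS a (a * a) -> in_aS (x * a) a.
Proof.
(* From a <= axa <= (aau)xa, this y also satisfies a <= aya, and it begins with a. The L-related
   ordered idempotents xa and ya are R-related, so xa lies in (yaS], inside (aS]. *)
move=> inv h [u hu]; set y := a * u * x.
have hy : a <= a * y * a.
  apply: (le_trans h); rewrite /y !mulgA; apply: osg_le_mul2r.
  exact: osg_le_mul2r.
have ex := ord_idempotent_mull h; have ey := ord_idempotent_mull hy.
have /(green_R_regularP (ord_idempotent_regular ex) (ord_idempotent_regular ey))[H _] :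
    green_R (x * a) (y * a).
  apply: right_pi_inverse_idem_L_R => //.
    by exists (x * a); rewrite -mulgA; apply: osg_le_mul2l; rewrite mulgA.
  by exists (y * a); rewrite -(mulgA y a); apply: osg_le_mul2l; rewrite mulgA.
by apply: (@in_aSM _ _ (u * x * a)); rewrite !mulgA.
Qed.

(** For mutually inverse a and x, [in_aS_sqr_inverse] applies to both: xa lies in (aS] and ax in
    (xS]. Then a is in (axS], ax in (xS] and x in (xaS]. *)
Lemma R_star_congruence_regular a : right_pi_inverse S ->
  congruence (@R_star d S) -> regular a ->
  exists2 x, a <= a * x * a & green_R a (x * a).
Proof.
move=> inv cR ra; have [x [ax xa]] := regular_inverse ra; exists x => //.
have rx : regular x by apply/regularP; exists a.
have rxa := ord_idempotent_regular (ord_idempotent_mull ax).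
apply/green_R_regularP => //; split; last first.
  by apply: in_aS_sqr_inverse => //; apply: R_star_congruence_sqr.
have : in_aS (a * x) x by apply: in_aS_sqr_inverse => //; apply: R_star_congruence_sqr.
have : in_aS a (a * x) by exists a.
move=> /in_aS_trans/[apply] /in_aS_trans; apply.
by exists x.
Qed.

End OrderedSemigroup.

(** * Right pi-t-simple subsemigroups described inside S *)

Definition subosg_of (d : Order.disp_t) (S : ordSemigroupType d) (A : set S)
    (hA : subsemigroup A) (x : S) (Ax : A x) : subosg hA :=
  exist _ x (mem_set Ax).

Lemma val_spow (d : Order.disp_t) (S : ordSemigroupType d) (A : set S)
    (hA : subsemigroup A) (x : subosg hA) n :
  val (spow x n) = spow (val x) n.
Proof. by elim: n => [|[|n] IH] //; rewrite !(spowS _ (ltn0Sn n)) valM IH. Qed.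

Section RightPiTSimple.
Variables (d : Order.disp_t) (S : ordSemigroupType d).
Implicit Types (a b c e f p q w x y : S) (m n k : nat).

(** Replaces a core living in a subtype of a subtype by a subset K of S. Right simplicity becomes:
    every y in K lies in (xK] for every x in K. *)
Lemma right_pi_t_simpleP (C : set S) (hC : subsemigroup C) :
  right_pi_t_simple (subosg hC) <->
  exists K : set S, [/\ K `<=` C,
    (forall x y, K x -> K y -> K (x * y)),
    (forall x y, K x -> K y -> exists2 v, K v & y <= x * v),
    (forall x, K x -> exists n v, [/\ (0 < n)%N, K v
       & spow x n <= spow x n * v * spow x n])
    & forall x, C x -> exists2 n, (0 < n)%N & K (spow x n)].
Proof.
split=> [[H [hH [simp reg pow]]]|[K [KC KM simp reg pow]]].
  exists [set val h | h in H]; split=> [_ [h _ <-]|_ _ [x Hx <-] [y Hy <-]|||].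
  - exact: set_mem (valP h).
  - by exists (x * y); [apply: (hH.2)|rewrite valM].
  - move=> _ _ [x Hx <-] [y Hy <-].
    pose x' := subosg_of hH Hx.
    pose y' := subosg_of hH Hy.
    (* The right ideal (x'H] of H must be all of H, so it contains y'. *)
    have idA : right_ideal [set z : subosg hH | in_aS z x'].
      split.
      - by exists (x' * x'); exists x'.
      - move=> _ [z [w zw] [t _ <-]]; exists (w * t).
        by rewrite mulgA; apply: osg_le_mul2r.
      - apply/seteqP; split=> [z [t [w tw] zt]|z zx]; last by exists z.
        by exists w; apply: le_trans zt tw.
    have : [set z : subosg hH | in_aS z x'] y' by rewrite (simp _ idA).
    move=> [v yv]; exists (val (val v)).
      by exists (val v) => //; apply: set_mem (valP v).
    have : val (val y') <= val (val (x' * v)) by exact: yv.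
    by rewrite !valM.
  - move=> _ [x Hx <-]; pose x' := subosg_of hH Hx.
    have [n n0 /regularP[v hv]] := reg x'; exists n, (val (val v)); split=> //.
      by exists (val v) => //; apply: set_mem (valP v).
    have : val (val (spow x' n)) <= val (val (spow x' n * v * spow x' n)) by exact: hv.
    by rewrite !valM !val_spow.
  - move=> x Cx; have [n n0 Hn] := pow (subosg_of hC Cx).
    by exists n => //; exists (spow (subosg_of hC Cx) n) => //; rewrite val_spow.
pose H : set (subosg hC) := [set x | K (val x)].
have hH : subsemigroup H.
  split=> [|x y Kx Ky]; last by rewrite /H/mkset valM; apply: KM.
  case: (hC.1) => x Cx; have [n n0 Kn] := pow x Cx.
  by exists (subosg_of hC (KC _ Kn)).
have lift x : K x -> exists h : subosg hH, val (val h) = x.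
  move=> Kx; have Hx : H (subosg_of hC (KC _ Kx)) by [].
  by exists (subosg_of hH Hx).
have Kval (h : subosg hH) : K (val (val h)) by exact: (set_mem (valP h)).
exists H, hH; split.
- move=> A [[b Ab] AM Adown]; apply/seteqP; split=> // c _.
  have [v Kv hv] := simp _ _ (Kval b) (Kval c); have [w wv] := lift _ Kv.
  rewrite -Adown; exists (b * w); first by apply: AM; exists b => //; exists w.
  by change (val (val c) <= val (val (b * w))); rewrite !valM wv.
- move=> x; have [n [v [n0 Kv hv]]] := reg _ (Kval x).
  have [w wv] := lift _ Kv; exists n => //; apply/regularP; exists w.
  change (val (val (spow x n)) <= val (val (spow x n * w * spow x n))).
  by rewrite !valM !val_spow wv.
- move=> x; have [n n0 Kn] := pow _ (set_mem (valP x)).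
  by exists n => //; rewrite /H/mkset val_spow.
Qed.

(** The ordered idempotents ax and xa share a class. Ordered idempotents e, f of one class have
    powers in its right simple core, so e <= e^m <= f^n v, which puts e in (fS]. *)
Lemma semilattice_of_regular a : semilattice_of S (@right_pi_t_simple d) ->
  regular a -> exists2 x, a <= a * x * a & green_R a (x * a).
Proof.
move=> [rho [[eqr _] _ comm] cl] ra; have /regularP[x ax] := ra; exists x => //.
have [hC /right_pi_t_simpleP[K [_ _ simp _ pow]]] := cl (a * x).
have re := ord_idempotent_mulr ax; have rf := ord_idempotent_mull ax.
have step e f : ord_idempotent e -> ord_idempotent f -> rho (a * x) e ->
    rho (a * x) f -> in_aS e f.
  move=> ee ff Ce Cf; have [m m0 Km] := pow _ Ce; have [n n0 Kn] := pow _ Cf.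
  have [v _ hv] := simp _ _ Kn Km.
  apply: (spow_in_aS n0); exists v; apply: le_trans hv.
  exact: ord_idempotent_le_spow.
have Ce : rho (a * x) (a * x) by reflexivity.
apply/green_R_regularP => //; first exact: ord_idempotent_regular.
split.
  by apply: (@in_aS_trans _ _ _ (a * x)); [exists a|apply: step].
by apply: (@in_aS_trans _ _ _ (a * x)); [apply: step|exists x; apply: lexx].
Qed.

End RightPiTSimple.

(** * Consequences of L being contained in R on regular elements *)

Section LStarSubRStar.
Variables (d : Order.disp_t) (S : ordSemigroupType d).
Implicit Types (a b c e f p q t w x y : S) (m n k : nat).
Hypothesis piS : pi_regular S.
Hypothesis LR : forall a b, regular a -> regular b -> green_L a b -> green_R a b.

(** From p <= pzp, replacing the last p by v(wp) gives wp <= (wp)(zv)(wp). *)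
Lemma regular_mull p v w : regular p -> p <= v * (w * p) -> regular (w * p).
Proof.
case/regularP=> z hz pv; apply/regularP; exists (z * v).
have : w * p <= w * (p * z * p) by exact: osg_le_mul2l.
rewrite -!mulgA => h; apply: (le_trans h).
by do 3!apply: osg_le_mul2l.
Qed.

Lemma mull_in_aS p v w : regular p -> p <= v * (w * p) ->
  in_aS p (w * p) /\ in_aS (w * p) p.
Proof.
move=> rp pv; have rwp := regular_mull rp pv.
apply/(green_R_regularP rp rwp)/LR => //; apply/green_L_regularP => //.
by split; [exists v|exists w].
Qed.

Lemma in_aS_mull p c : regular p -> in_aS p c -> exists2 w, p <= c * (w * p) &
  in_aS p (w * p) /\ in_aS (w * p) p.
Proof.
move=> rp [w pw]; have /regularP[z pz] := rp.
have h : p <= c * (w * z * p).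
  by apply: (le_trans pz); rewrite !mulgA; do 2!apply: osg_le_mul2r.
by exists (w * z) => //; apply: mull_in_aS h.
Qed.

(** The filter property. If p <= cb(wp), then bwp is R-related to p, so p lies in (bS]. Conversely,
    p <= c(wp), wp <= pt and p <= bu give p <= cb(ut). *)
Lemma in_aSMr p c b : regular p -> in_aS p (c * b) <-> in_aS p c /\ in_aS p b.
Proof.
move=> rp; split=> [pcb|[pc pb]].
  split; first exact: in_aSM pcb.
  have [w h _] := in_aS_mull rp pcb.
  have [] : in_aS p (b * w * p) /\ in_aS (b * w * p) p.
    by apply: (@mull_in_aS _ c); rewrite // !mulgA in h *.
  by rewrite -mulgA => /in_aSM.
have [w h [_ [t wt]]] := in_aS_mull rp pc; case: pb => u pu.
exists (u * t); apply: (le_trans h); rewrite -mulgA; apply: osg_le_mul2l.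
by apply: (le_trans wt); rewrite mulgA; apply: osg_le_mul2r.
Qed.

Lemma in_aS_spow p c m : regular p -> (0 < m)%N -> in_aS p c -> in_aS p (spow c m).
Proof.
move=> rp + pc; elim: m => [//|[//|m] IH] _.
by rewrite spowS //; apply/in_aSMr => //; split=> //; apply: IH.
Qed.

(** The preorder whose equivalence is R*. Any regular power of a may serve, by [star_leE], so
    minimality of the exponent is not imposed. *)
Definition star_le a c :=
  exists m, [/\ (0 < m)%N, regular (spow a m) & in_aS (spow a m) c].

(** As a^k lies in (aS], the filter property puts it in (a^m S] for every positive m. *)
Lemma star_leE a c k : (0 < k)%N -> regular (spow a k) ->
  star_le a c <-> in_aS (spow a k) c.
Proof.
move=> k0 rk; split=> [[m [m0 rm mc]]|kc]; last by exists k.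
apply: in_aS_trans mc; apply: in_aS_spow => //.
exact: spow_in_aS k0 (regular_in_aS rk).
Qed.

Lemma star_le_refl a : star_le a a.
Proof.
have [m m0 rm] := piS a; exists m; split=> //.
exact: spow_in_aS m0 (regular_in_aS rm).
Qed.

Lemma star_le_spow a c m : (0 < m)%N -> star_le a (spow c m) <-> star_le a c.
Proof.
move=> m0; have [k k0 rk] := piS a; rewrite !(star_leE _ k0 rk).
by split=> h; [exact: spow_in_aS h|exact: in_aS_spow].
Qed.

Lemma star_le_trans a b c : star_le a b -> star_le b c -> star_le a c.
Proof.
move=> ab [n [n0 rn nc]]; move/(star_le_spow _ _ n0): ab => [m [m0 rm mn]].
by exists m; split=> //; apply: in_aS_trans mn nc.
Qed.

Lemma star_leMr a b c : star_le a (b * c) <-> star_le a b /\ star_le a c.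
Proof.
by have [k k0 rk] := piS a; rewrite !(star_leE _ k0 rk); apply: in_aSMr.
Qed.

Lemma R_starE a b : R_star a b <-> star_le a b /\ star_le b a.
Proof.
have [m am] := pi_regular_least_exponent a piS.
have [n bn] := pi_regular_least_exponent b piS.
have [m0 rm _] := am; have [n0 rn _] := bn.
rewrite -(star_le_spow a b n0) -(star_le_spow b a m0).
rewrite (star_leE _ m0 rm) (star_leE _ n0 rn) -green_R_regularP //.
split=> [[m' [n' [am' bn']]]|h]; last by exists m, n.
by rewrite (least_regular_exponent_uniq am am') (least_regular_exponent_uniq bn bn').
Qed.

Lemma R_star_spow a m : (0 < m)%N -> R_star a (spow a m).
Proof.
move=> m0; apply/R_starE; split.
  by apply/(star_le_spow _ _ m0)/star_le_refl.
by apply/(star_le_spow _ _ m0)/star_le_refl.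
Qed.

Lemma in_aS_star_le a c : in_aS a c -> star_le a c.
Proof.
move=> ac; have [m [m0 rm ma]] := star_le_refl a.
by exists m; split=> //; apply: in_aS_trans ma ac.
Qed.

Lemma star_leM a b a' b' : star_le a a' -> star_le b b' ->
  star_le (a * b) (a' * b').
Proof.
move=> aa bb; have /star_leMr[ha hb] := star_le_refl (a * b).
by apply/star_leMr; split; [apply: star_le_trans ha aa|apply: star_le_trans hb bb].
Qed.

Lemma R_star_semilattice_congruence : semilattice_congruence (@R_star d S).
Proof.
have xx := star_le_refl; split=> [|a|a b].
- split; first split.
  + by move=> a; apply/R_starE.
  + by move=> a b /R_starE[ab ba]; apply/R_starE.
  + move=> a b c /R_starE[ab ba] /R_starE[bc cb]; apply/R_starE.
    by split; [apply: star_le_trans ab bc|apply: star_le_trans cb ba].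
  + by move=> x a b /R_starE[ab ba]; split; apply/R_starE; split; apply: star_leM.
- apply/R_starE; split; first by apply/star_leMr.
  by have /star_leMr[] := xx (a * a).
- have sym x y : star_le (x * y) (y * x).
    by apply/star_leMr; have /star_leMr[] := xx (x * y).
  by apply/R_starE.
Qed.

Lemma semilattice_of_right_pi_t_simple :
  semilattice_of S (@right_pi_t_simple d).
Proof.
have sc := R_star_semilattice_congruence.
have [[eqR comp] sqr _] := sc; exists (@R_star d S) => // a.
have hC : subsemigroup [set b | R_star a b].
  split; first by exists a => /=; reflexivity.
  move=> x y /= ax ay; transitivity (a * a); first exact: sqr.
  by transitivity (a * y); [apply: (comp _ _ _ ay).1|apply: (comp _ _ _ ax).2].
exists hC; apply/right_pi_t_simpleP.
have [m m0 rp] := piS a; set p := spow a m in rp.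
pose F := star_le a; have FE c : F c <-> in_aS p c by apply: star_leE.
have FM c b : F (c * b) <-> F c /\ F b by apply: star_leMr.
have Fp : F p by apply/FE/regular_in_aS.
(* Regular elements of the class lie in (pF]: q <= p(wq) with q in (wqS], and p in (qS] then gives
   wq in F. *)
have regF q : regular q -> R_star a q -> exists2 t, F t & q <= p * t.
  move=> rq /R_starE[aq qa].
  have : in_aS q p.
    by rewrite -[q]spow1 -star_leE //; apply/star_le_spow.
  case/(in_aS_mull rq) => w qw [qwq _]; exists (w * q) => //.
  apply/FE; apply: in_aS_trans qwq; exact/FE.
pose K := [set c | F c /\ exists2 t, F t & c <= p * t].
have KC c : K c -> R_star a c.
  move=> [Fc [t _ ct]]; apply/R_starE; split=> //.
  by apply/(star_le_spow _ _ m0)/in_aS_star_le; exists t.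
(* The source of elements of K: wp' is regular and R-related to p', so [regF] applies to it. *)
have Kmull p' v w : R_star a p' -> regular p' -> p' <= v * (w * p') -> K (w * p').
  move=> ap' rp' h; have rw := regular_mull rp' h.
  have [h1 h2] := mull_in_aS rp' h.
  have aw : R_star a (w * p').
    transitivity p' => //; apply/R_star_regular => //; exact/green_R_regularP.
  by split; [have /R_starE[] := aw|apply: regF].
have Rp : R_star a p.
  exact: R_star_spow.
exists K; split=> //.
- move=> x y [Fx [t Ft xt]] [Fy _]; split; first exact/FM.
  exists (t * y); first exact/FM.
  by rewrite mulgA; apply: osg_le_mul2r.
(* Right simplicity: y <= pt <= x(wpt), where wp is in K and t in F, so wpt is in K. *)
- move=> x y [Fx _] [Fy [t Ft yt]].
  have [w pw _] : exists2 w, p <= x * (w * p) & _ := in_aS_mull rp ((FE x).1 Fx).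
  have [Fw [s Fs ws]] := Kmull _ _ _ Rp rp pw.
  exists (w * p * t); last first.
    by apply: (le_trans yt); rewrite mulgA; apply: osg_le_mul2r.
  split; first exact/FM.
  exists (s * t); first exact/FM.
  by rewrite (mulgA p); apply: osg_le_mul2r.
- move=> x Kx; have [n n0 rq] := piS x; set q := spow x n in rq *.
  have Rq : R_star a q.
    transitivity x; first exact: KC.
    exact: R_star_spow.
  have /regularP[z qz] := rq.
  (* The inner inverse z is only known to lie in F, but zq is in K. Hence zqz is in K, and q <= qzq
     <= q(zqz)q. *)
  have [Fzq [t Ft zt]] : K (z * q) by apply: (Kmull _ q); rewrite // mulgA.
  have /FM[Fz _] := Fzq.
  exists n, (z * q * z); split=> //.
    split; first exact/FM.
    exists (t * z); first exact/FM.
    by rewrite (mulgA p); apply: osg_le_mul2r.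
  apply: (le_trans qz); rewrite -/q !mulgA; do 2!apply: osg_le_mul2r.
  exact: qz.
- move=> x ax; have [n n0 rq] := piS x; exists n => //.
  have Rq : R_star a (spow x n).
    by transitivity x => //; apply: R_star_spow.
  by split; [have /R_starE[] := Rq|apply: regF].
Qed.

End LStarSubRStar.

Theorem theorem3p7 (d : Order.disp_t) (S : ordSemigroupType d)
    (hS : right_pi_inverse S) :
  [<-> congruence (@R_star d S);
       forall a b : S, L_star a b -> R_star a b;
       semilattice_of S (@right_pi_t_simple d);
       semilattice_congruence (@R_star d S)].
Proof.
have piS := hS.1.
have regL := regular_L_sub_R hS.
tfae.
- move=> cR; apply/L_star_sub_R_starP/regL => a.
  exact: R_star_congruence_regular.
- by move/L_star_sub_R_starP; apply: semilattice_of_right_pi_t_simple.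
(* The congruence given by (3) need not be R* a priori; it first yields the inclusion of L in R on
   regular elements. *)
- move=> sl; apply: R_star_semilattice_congruence => //; apply: regL => a.
  exact: semilattice_of_regular.
- by case.
Qed.
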